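(* Let $A\in\mathbb{R}^{n\times m}$ have rank $r$ and be $(\mu_1,\mu_2)$-incoherent, let $p\in(0,1]$, and let $Z$ be the wedge matrix of $A$ at rate $p$ (defined in the context). There is an absolute constant $C>0$ such that for any $a>2$, with probability at least $1-O(n^{-a})$, \[ \|Z-AA^\top\|\le C\left(\sqrt{\frac{a\mu_1\mu_2 r^2\log n}{pmn}}+\frac{a\mu_1\mu_2r^2\log n}{pmn}\right)\|A\|^2 . \]
   Context: $\|\cdot\|$ denotes the spectral (operator) norm. A rank-$r$ matrix $A\in\mathbb{R}^{n\times m}$ with compact SVD $A=U\Sigma V^\top$ ($U\in\mathbb{R}^{n\times r},V\in\mathbb{R}^{m\times r}$) is $(\mu_1,\mu_2)$-incoherent if $\max_i\|U_{i,\cdot}\|_2^2\le \mu_1 r/n$ and $\max_j\|V_{j,\cdot}\|_2^2\le\mu_2 r/m$. Wedge sampling: let $\mathcal W=\{(i,\ell,j):1\le i\le j\le n,\ \ell\in[m]\}$; each triple in $\mathcal W$ is included in $\tilde{\mathcal W}$ independently with probability $p$ (for each sampled triple, the entries $A_{i\ell},A_{j\ell}$ are observed). With $E_{ij}=e_ie_j^\top$ and $Z_{i\ell j}=p^{-1}A_{i\ell}A_{j\ell}E_{ij}\mathbf 1\{(i,\ell,j)\in\tilde{\mathcal W}\}$, the wedge matrix is $Z=\sum_{i<j,\ \ell\in[m]}(Z_{i\ell j}+Z_{i\ell j}^\top)+\sum_{i\in[n],\ell\in[m]}Z_{i\ell i}$, which satisfies $\mathbb E Z=AA^\top$. *)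

(* Defs.v *)
From HB Require Import structures.
From mathcomp Require Import all_boot all_order all_algebra.
From mathcomp Require Import all_classical all_reals.
From mathcomp Require Import exp Rstruct.
Set Implicit Arguments. Unset Strict Implicit. Unset Printing Implicit Defensive.
Import Order.TTheory GRing.Theory Num.Theory.
Local Open Scope ring_scope.

Notation RR := Rdefinitions.R.

Definition vnorm2 (k : nat) (x : 'cV[RR]_k) : RR :=
  Num.sqrt (\sum_(i < k) x i 0 ^+ 2).

Definition spec_norm (n m : nat) (M : 'M[RR]_(n, m)) : RR :=
  sup [set y : RR | exists x : 'cV[RR]_m, vnorm2 x <= 1 /\ y = vnorm2 (M *m x)].

Definition incoherent (n m : nat) (A : 'M[RR]_(n, m)) (r : nat) (mu1 mu2 : RR) : Prop :=
  exists (U : 'M[RR]_(n, r)) (S : 'rV[RR]_r) (V : 'M[RR]_(m, r)),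
    U^T *m U = 1%:M /\ V^T *m V = 1%:M /\ (forall k, 0 < S 0 k) /\
    A = U *m diag_mx S *m V^T /\
    (forall i, \sum_(k < r) U i k ^+ 2 <= mu1 * r%:R / n%:R) /\
    (forall j, \sum_(k < r) V j k ^+ 2 <= mu2 * r%:R / m%:R).

(* Sample space: a subset of triples (i, l, j), encoded as ((i, l), j). *)
Definition Omega (n m : nat) := {ffun 'I_n * 'I_m * 'I_n -> bool}.

Definition inW (n m : nat) (t : 'I_n * 'I_m * 'I_n) : bool := (t.1.1 <= t.2)%N.

(* Probability weight of an outcome: each triple of W is included independently
   with probability p; triples outside W are never included. *)
Definition weight (n m : nat) (p : RR) (w : Omega n m) : RR :=
  \prod_(t : 'I_n * 'I_m * 'I_n)
     (if inW t then (if w t then p else 1 - p) else (if w t then 0 else 1)).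

Definition prob (n m : nat) (p : RR) (E : Omega n m -> Prop) : RR :=
  \sum_(w : Omega n m) (if `[< E w >] then weight p w else 0).

Definition Zilj (n m : nat) (A : 'M[RR]_(n, m)) (p : RR) (w : Omega n m)
  (i : 'I_n) (l : 'I_m) (j : 'I_n) : 'M[RR]_n :=
  (p^-1 * A i l * A j l * (if w ((i, l), j) then 1 else 0)) *: delta_mx i j.

Definition wedge (n m : nat) (A : 'M[RR]_(n, m)) (p : RR) (w : Omega n m) : 'M[RR]_n :=
  \sum_(i < n) \sum_(j < n | (i < j)%N) \sum_(l < m)
      (Zilj A p w i l j + (Zilj A p w i l j)^T)
  + \sum_(i < n) \sum_(l < m) Zilj A p w i l i.

(* Main.v *)
Require Import Defs.
From mathcomp Require Import all_boot all_order all_algebra.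
From mathcomp Require Import all_classical all_reals.
From mathcomp Require Import Rstruct sequences exp ring lra zify.
Set Implicit Arguments.
Unset Strict Implicit.
Unset Printing Implicit Defensive.
Import Order.TTheory GRing.Theory Num.Theory.
Local Open Scope ring_scope.

(** Put [X := Z - A A^T], a sum over the triples [t] of independent centered
    matrices [(w t - p) B_t], where [B_t] is a multiple of [E_ij + E_ji], so
    that [B_t^2] is diagonal. The proof is a polynomial moment estimate for [X].

    Resampling the coordinate [t] turns [X] into [X'_t], and [(X, X'_t)] is an
    exchangeable pair. With a mean value inequality for traces of powers this
    gives [2 E tr X^(2k) <= (2k-1) E tr (D X^(2k-2))] for the diagonal matrix
    [D := sum_t E[(X - X'_t)^2 | X]]. Log-convexity of [j |-> (X^(2j))_xx] and
    Young's inequality then yield [E tr X^(2k) <= sum_x E ((2k-1) D_xx)^k]. Each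
    [D_xx] is a sum of independent bounded scalars, whose moments obey
    [E D_xx^k <= (M + k L)^k], with [M] a variance proxy and [L] an almost sure
    bound, both read off from the incoherence of [A]. Markov's inequality with
    [k] about [a log n] concludes. *)

(** * Convex and log-convex sequences *)

Section ConvexSequences.
Variable R : realDomainType.
Implicit Types (g h : nat -> R) (I : finType).

Lemma convex_seq_add_rev_le g (u : nat) :
  (forall s, (s.+2 <= u)%N -> g s.+1 *+ 2 <= g s + g s.+2) ->
  forall s, (s <= u)%N -> g s + g (u - s)%N <= g 0%N + g u.
Proof.
move=> convex_g.
have increment_le j k : (j <= k)%N -> (k < u)%N ->
    g j.+1 + g k <= g j + g k.+1.
  move/subnKC <-; elim: (k - j)%N => [|d IHd]; first by rewrite addn0 addrC.
  rewrite addnS => lt_u; have := IHd (ltnW lt_u); have := convex_g _ lt_u.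
  by rewrite mulr2n; lra.
have shift_le s k : (k + s <= u)%N -> g s + g k <= g 0%N + g (k + s)%N.
  elim: s => [|s IHs] le_u; first by rewrite addn0.
  rewrite addnS in le_u *; have := IHs (ltnW le_u).
  by have := increment_le s (k + s)%N (leq_addl _ _) le_u; lra.
by move=> s le_su; rewrite -{2}(subnK le_su) shift_le ?subnK.
Qed.

Lemma sum_sqr_ge0 I (x : I -> R) : 0 <= \sum_i x i ^+ 2.
Proof. by apply: sumr_ge0 => i _; exact: sqr_ge0. Qed.

Lemma cauchy_schwarz_sum I (x y : I -> R) :
  (\sum_i x i * y i) ^+ 2 <= (\sum_i x i ^+ 2) * (\sum_i y i ^+ 2).
Proof.
have lagrange : \sum_i \sum_j (x i * y j - x j * y i) ^+ 2 =
    ((\sum_i x i ^+ 2) * (\sum_i y i ^+ 2) - (\sum_i x i * y i) ^+ 2) *+ 2.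
  have prodE (f g : I -> R) :
      (\sum_i f i) * (\sum_j g j) = \sum_i \sum_j f i * g j.
    by rewrite mulr_suml; under eq_bigr do rewrite mulr_sumr.
  rewrite mulrnBl mulr2n {2}[_ * _ in RHS]mulrC [_ ^+ 2 in RHS]expr2 !prodE.
  rewrite -big_split -sumrMnl -sumrB; apply: eq_bigr => i _ /=.
  rewrite -big_split -sumrMnl -sumrB; apply: eq_bigr => j _ /=; ring.
rewrite -subr_ge0 -(pmulrn_lge0 _ (ltn0Sn 1)) -lagrange.
by do 2![apply: sumr_ge0 => ? _]; exact: sqr_ge0.
Qed.

Definition logconvex h : Prop := forall j, h j.+1 ^+ 2 <= h j * h j.+2.

Section LogConvex.
Variable h : nat -> R.
Hypothesis h_ge0 : forall j, 0 <= h j.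
Hypothesis h_logconvex : logconvex h.

Lemma logconvex_ratio_le j k : (j <= k)%N -> h j.+1 * h k <= h j * h k.+1.
Proof.
move/subnKC <-; elim: (k - j)%N => [|d IHd]; first by rewrite addn0 mulrC.
rewrite addnS; set i := (j + d)%N in IHd *.
have := h_ge0 i.+1; rewrite le0r => /predU1P[->|hi_gt0].
  by rewrite mulr0 mulr_ge0.
rewrite -(ler_pM2r hi_gt0) -mulrA -expr2.
apply: le_trans (ler_wpM2l (h_ge0 _) (h_logconvex i)) _.
by rewrite mulrA [leRHS]mulrAC ler_wpM2r.
Qed.

Lemma logconvex_exp_le k : h 0%N <= 1 -> h 1%N ^+ k.+1 <= h k.+1.
Proof.
move=> h0_le1; elim: k => [|k IHk]; first by rewrite expr1.
rewrite exprS; apply: le_trans (ler_wpM2l (h_ge0 1) IHk) _.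
apply: le_trans (logconvex_ratio_le (leq0n _)) _.
by rewrite ler_piMl.
Qed.

Lemma logconvex_geometric_le c k :
  0 <= c -> h k.+1 <= c * h k -> h k <= c ^+ k * h 0%N.
Proof.
move=> c_ge0 hk_le.
have := h_ge0 k; rewrite le0r => /predU1P[->|hk_gt0].
  by rewrite mulr_ge0 ?exprn_ge0.
have ratio_le j : (j < k)%N -> h j.+1 <= c * h j.
  move=> /ltnW le_jk; rewrite -(ler_pM2r hk_gt0).
  apply: le_trans (logconvex_ratio_le le_jk) _.
  by rewrite mulrAC mulrC ler_wpM2r.
elim: {hk_le hk_gt0} k ratio_le => [|k IHk] ratio_le; first by rewrite mul1r.
apply: le_trans (ratio_le k _) _ => //.
rewrite exprS -mulrA ler_wpM2l ?IHk //.
by move=> j /ltnW/ratio_le.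
Qed.

Lemma logconvex_young c k :
  h 0%N <= 1 -> 0 <= c -> c * h k <= h k.+1 + c ^+ k.+1.
Proof.
move=> h0_le1 c_ge0; have [le_h|/ltW h_le] := leP (c * h k) (h k.+1).
  by rewrite (le_trans le_h) // lerDl exprn_ge0.
rewrite -[leLHS]add0r lerD // exprS ler_wpM2l //.
apply: le_trans (logconvex_geometric_le c_ge0 h_le) _.
by rewrite ler_piMr // exprn_ge0.
Qed.

End LogConvex.
End ConvexSequences.

(** * Trace inequalities for symmetric matrices *)

Lemma subrXX_telescope (R : pzRingType) (x y : R) (N : nat) :
  x ^+ N - y ^+ N = \sum_(q < N) x ^+ q * (x - y) * y ^+ (N.-1 - q).
Proof.
pose f q := x ^+ q * y ^+ (N - q).
have -> : x ^+ N - y ^+ N = f N - f 0%N.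
  by rewrite /f subnn subn0 !expr0 mulr1 mul1r.
rewrite -telescope_sumr // big_mkord; apply: eq_bigr => q _.
have Nq : (N - q)%N = (N.-1 - q).+1 by have := ltn_ord q; lia.
by rewrite mulrBr mulrBl -exprSr -mulrA -exprS -Nq /f subnS Nq.
Qed.

Section MatrixIdentities.
Variables (R : comNzRingType) (n : nat).
Implicit Types (S M N : 'M[R]_n) (v : 'cV[R]_n).

Lemma expr2_scalemx c M : (c *: M) ^+ 2 = c ^+ 2 *: M ^+ 2.
Proof. by rewrite !expr2 -!mulmxE -scalemxAl -scalemxAr scalerA. Qed.

Lemma trmx_expr M k : (M ^+ k)^T = M^T ^+ k.
Proof.
elim: k => [|k IHk]; first by rewrite !expr0 trmx1.
by rewrite exprS -mulmxE trmx_mul IHk mulmxE exprSr.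
Qed.

Lemma trmx_expr_sym S k : S^T = S -> (S ^+ k)^T = S ^+ k.
Proof. by rewrite trmx_expr => ->. Qed.

Lemma mxtrace_trmx_mul M N : \tr (M^T * N) = \sum_i \sum_j M i j * N i j.
Proof.
rewrite /mxtrace exchange_big /=; apply: eq_bigr => j _.
by rewrite mxE; apply: eq_bigr => i _; rewrite mxE.
Qed.

Definition sqnorm v : R := \sum_i v i 0 ^+ 2.

Lemma sum_mulmx_expr_sym S v i j : S^T = S ->
  \sum_x (S ^+ i *m v) x 0 * (S ^+ j *m v) x 0 = (v^T *m S ^+ (i + j) *m v) 0 0.
Proof.
move=> S_sym; rewrite exprD -mulmxE mulmxA -{2}(trmx_expr_sym i S_sym).
rewrite -trmx_mul -mulmxA mxE; apply: eq_bigr => x _.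
by rewrite [in RHS]mxE.
Qed.

Lemma sqnorm_expr_delta S (x : 'I_n) j : S^T = S ->
  sqnorm (S ^+ j *m delta_mx x 0) = (S ^+ j.*2) x x.
Proof.
move=> S_sym; rewrite /sqnorm; under eq_bigr do rewrite expr2.
by rewrite sum_mulmx_expr_sym // trmx_delta -rowE -colE addnn !mxE.
Qed.

Lemma sqnorm_col_orthonormal (r : nat) (Q : 'M[R]_(n, r)) k :
  Q^T *m Q = 1%:M -> sqnorm (col k Q) = 1.
Proof.
move=> /matrixP/(_ k k); rewrite !mxE eqxx mulr1n => <-.
by apply: eq_bigr => i _; rewrite !mxE expr2.
Qed.

Lemma sum_sqr_mulmx_trmx (m r : nat) (X : 'M[R]_(n, r))
    (Q : 'M[R]_(m, r)) (i : 'I_n) :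
  Q^T *m Q = 1%:M -> \sum_l (X *m Q^T) i l ^+ 2 = \sum_k X i k ^+ 2.
Proof.
have sum_sqrE (q : nat) (Y : 'M[R]_(n, q)) :
    \sum_l Y i l ^+ 2 = (Y *m Y^T) i i.
  by rewrite mxE; apply: eq_bigr => l _; rewrite mxE expr2.
by move=> QQ; rewrite !sum_sqrE trmx_mul trmxK mulmxA -(mulmxA X) QQ mulmx1.
Qed.

End MatrixIdentities.

Section TraceInequalities.
Variables (R : realDomainType) (n : nat).
Implicit Types (S W Y D M N : 'M[R]_n) (v : 'cV[R]_n).

Lemma mxtrace_trmx_mul_ge0 M : 0 <= \tr (M^T * M).
Proof.
rewrite mxtrace_trmx_mul; apply: sumr_ge0 => i _; apply: sumr_ge0 => j _.
by rewrite -expr2 sqr_ge0.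
Qed.

Lemma mxtrace_expr_double_ge0 S k : S^T = S -> 0 <= \tr (S ^+ k.*2).
Proof.
move=> S_sym; rewrite -addnn exprD -{1}(trmx_expr_sym k S_sym).
exact: mxtrace_trmx_mul_ge0.
Qed.

Lemma mxtrace_trmx_mul_AMGM M N :
  \tr (M^T * N) *+ 2 <= \tr (M^T * M) + \tr (N^T * N).
Proof.
rewrite !mxtrace_trmx_mul -sumrMnl -big_split; apply: ler_sum => i _ /=.
rewrite -sumrMnl -big_split; apply: ler_sum => j _ /=.
by have := sqr_ge0 (M i j - N i j); rewrite sqrrB mulr2n -!expr2; lra.
Qed.

Section Sandwich.
Variables (D W Y : 'M[R]_n) (u : nat).
Hypothesis D_sym : D^T = D.
Hypothesis W_sym : W^T = W.
Hypothesis Y_sym : Y^T = Y.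

Let F s := W ^+ s * D * Y ^+ (u - s).

Lemma mxtrace_trmx_mul_sandwich s t : (s <= u)%N -> (t <= u)%N ->
  \tr ((F s)^T * F t) = \tr (D * W ^+ (s + t) * D * Y ^+ (u.*2 - (s + t))).
Proof.
move=> le_su le_tu; have -> : (u.*2 - (s + t) = u - t + (u - s))%N by lia.
rewrite /F -!mulmxE !trmx_mul !trmx_expr_sym // D_sym -!mulmxA.
by rewrite mxtrace_mulC !mulmxE !exprD !mulrA.
Qed.

Let frob s := \tr ((F s)^T * F s).

Lemma sandwich_frob_add_rev_le s : (s <= u)%N ->
  frob s + frob (u - s)%N <=
  \tr (D ^+ 2 * W ^+ u.*2) + \tr (D ^+ 2 * Y ^+ u.*2).
Proof.
move=> le_su; apply: (@le_trans _ _ (frob 0%N + frob u)).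
  apply: convex_seq_add_rev_le le_su => {}s lt_su.
  rewrite {1}/frob mxtrace_trmx_mul_sandwich ?(ltnW lt_su) // addSnnS.
  rewrite -mxtrace_trmx_mul_sandwich ?(ltnW (ltnW lt_su)) //.
  exact: mxtrace_trmx_mul_AMGM.
rewrite /frob !mxtrace_trmx_mul_sandwich // addn0 subn0 addnn subnn !expr0.
by rewrite !mulr1 addrC expr2 lerD2r -!mulmxE [leLHS]mxtrace_mulC mulmxA lexx.
Qed.

(* The trace with exponent [q] is the Frobenius product of [F s] and [F t] for
   any [s + t = q]. Hence its even-indexed values are convex in [s], and an odd
   one lies below the mean of its two neighbours. *)
Lemma mxtrace_sandwich_add_rev_le q : (q <= u.*2)%N ->
  \tr (D * W ^+ q * D * Y ^+ (u.*2 - q)) +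
  \tr (D * W ^+ (u.*2 - q) * D * Y ^+ q) <=
  \tr (D ^+ 2 * W ^+ u.*2) + \tr (D ^+ 2 * Y ^+ u.*2).
Proof.
move=> le_q.
have cross_le s t : (s <= u)%N -> (t <= u)%N ->
    \tr (D * W ^+ (s + t) * D * Y ^+ (u.*2 - (s + t))) *+ 2 <= frob s + frob t.
  move=> le_su le_tu; rewrite -mxtrace_trmx_mul_sandwich //.
  exact: mxtrace_trmx_mul_AMGM.
have [half_le uphalf_le] : (q./2 <= u)%N /\ (uphalf q <= u)%N by lia.
have := sandwich_frob_add_rev_le half_le.
have := sandwich_frob_add_rev_le uphalf_le.
have := cross_le _ _ (leq_subr q./2 u) (leq_subr (uphalf q) u).
have := cross_le _ _ half_le uphalf_le; rewrite !mulr2n.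
have -> : (q./2 + uphalf q = q)%N by lia.
have -> : (u - q./2 + (u - uphalf q) = u.*2 - q)%N by lia.
rewrite subKn //; lra.
Qed.

End Sandwich.

Lemma mxtrace_mean_value_le W Y (u : nat) : W^T = W -> Y^T = Y ->
  \tr ((W - Y) * (W ^+ u.*2.+1 - Y ^+ u.*2.+1)) *+ 2 <=
  u.*2.+1%:R *
    (\tr ((W - Y) ^+ 2 * W ^+ u.*2) + \tr ((W - Y) ^+ 2 * Y ^+ u.*2)).
Proof.
move=> W_sym Y_sym; set D := W - Y.
have D_sym : D^T = D by rewrite linearB /= W_sym Y_sym.
rewrite subrXX_telescope mulr_sumr raddf_sum mulr2n /=.
rewrite {2}(reindex_inj rev_ord_inj) -big_split mulr_natl.
rewrite -[X in _ *+ X](card_ord u.*2.+1) -sumr_const.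
apply: ler_sum => q _ /=; have le_q : (q <= u.*2)%N by rewrite -ltnS.
by rewrite !mulrA subSS (subKn le_q) mxtrace_sandwich_add_rev_le.
Qed.

Lemma sqnorm_ge0 v : 0 <= sqnorm v.
Proof. exact: sum_sqr_ge0. Qed.

Lemma sqnorm_mulmx_le M v : sqnorm (M *m v) <= \tr (M^T * M) * sqnorm v.
Proof.
rewrite mxtrace_trmx_mul mulr_suml; apply: ler_sum => i _; rewrite mxE.
exact: cauchy_schwarz_sum.
Qed.

Lemma sqnorm_expr_logconvex S v : S^T = S ->
  logconvex (fun j => sqnorm (S ^+ j *m v)).
Proof.
move=> S_sym j; apply: le_trans (cauchy_schwarz_sum _ _).
by rewrite sum_mulmx_expr_sym // addnS -addSn -sum_mulmx_expr_sym.
Qed.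

Lemma sqnorm_mulmx_exp_le_trace S v k : S^T = S -> sqnorm v <= 1 ->
  sqnorm (S *m v) ^+ k.+1 <= \tr (S ^+ k.+1.*2).
Proof.
move=> S_sym v_le1.
have := logconvex_exp_le (fun=> sqnorm_ge0 _) (sqnorm_expr_logconvex v S_sym) k.
rewrite expr0 mul1mx expr1 => /(_ v_le1)/le_trans; apply.
apply: le_trans (sqnorm_mulmx_le _ _) _; rewrite trmx_expr_sym // -exprD addnn.
by rewrite ler_piMr // mxtrace_expr_double_ge0.
Qed.

Lemma mxtrace_diag_mul_young S (d : 'rV[R]_n) c u :
  S^T = S -> 0 <= c -> (forall x, 0 <= d 0 x) ->
  c * \tr (diag_mx d * S ^+ u.*2) <=
  \tr (S ^+ u.+1.*2) + \sum_x (c * d 0 x) ^+ u.+1.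
Proof.
move=> S_sym c_ge0 d_ge0; rewrite -mulmxE mulr_sumr -big_split.
apply: ler_sum => x _; rewrite mul_diag_mx mxE mulrA -!sqnorm_expr_delta //.
apply: logconvex_young (sqnorm_expr_logconvex _ S_sym) _ _ _ _ => [j||].
- exact: sqnorm_ge0.
- by rewrite sqnorm_expr_delta // double0 expr0 mxE eqxx.
- by rewrite mulr_ge0.
Qed.

End TraceInequalities.

(** * Products of finite probability spaces *)

Section ProductMean.
Variables (R : numDomainType) (T S : finType) (P : T -> S -> R).
Implicit Types (w : {ffun T -> S}) (f : {ffun T -> S} -> R).
Implicit Types (g : {ffun T -> S} -> {ffun T -> S} -> R) (t : T) (s : S).

Definition prod_weight w : R := \prod_t P t (w t).

Definition prod_mean f : R := \sum_w prod_weight w * f w.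

Definition resample w t s : {ffun T -> S} :=
  [ffun u => if u == t then s else w u].

(* [(w, w')] is the exchangeable pair obtained by drawing the coordinate [t] of
   [w'] afresh. *)
Definition resample_mean t g : R :=
  prod_mean (fun w => \sum_s P t s * g w (resample w t s)).

Lemma resampleE w t s : resample w t s t = s.
Proof. by rewrite ffunE eqxx. Qed.

Lemma resample_neq w t s u : u != t -> resample w t s u = w u.
Proof. by rewrite ffunE => /negPf->. Qed.

Lemma resampleK w t s : resample (resample w t s) t (w t) = w.
Proof. by apply/ffunP => u; rewrite !ffunE; case: eqP => [->|]. Qed.

Lemma prod_weight_resample w t s :
  prod_weight (resample w t s) * P t (w t) = prod_weight w * P t s.
Proof.
rewrite /prod_weight (bigD1 t) // [in RHS](bigD1 t) //= resampleE mulrC mulrCA.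
rewrite [RHS]mulrC; congr (_ * (_ * _)); apply: eq_bigr => u ut.
by rewrite resample_neq.
Qed.

Lemma resample_meanC t g :
  resample_mean t g = resample_mean t (fun w w' => g w' w).
Proof.
have meanE h : resample_mean t h = \sum_(ws : {ffun T -> S} * S)
    prod_weight ws.1 * P t ws.2 * h ws.1 (resample ws.1 t ws.2).
  rewrite /resample_mean /prod_mean; under eq_bigr do rewrite mulr_sumr.
  by rewrite pair_bigA; apply: eq_bigr => ws _; rewrite mulrA.
pose swap (ws : {ffun T -> S} * S) := (resample ws.1 t ws.2, ws.1 t).
have swapK : involutive swap.
  by move=> [w s]; rewrite /swap /= resampleK resampleE.
rewrite !meanE (reindex_inj (inv_inj swapK)); apply: eq_bigr => -[w s] _ /=.
by rewrite resampleK prod_weight_resample.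
Qed.

Lemma eq_prod_mean f1 f2 : f1 =1 f2 -> prod_mean f1 = prod_mean f2.
Proof. by move=> eq_f; apply: eq_bigr => w _; rewrite eq_f. Qed.

Lemma prod_meanD f1 f2 :
  prod_mean (fun w => f1 w + f2 w) = prod_mean f1 + prod_mean f2.
Proof. by rewrite -big_split; apply: eq_bigr => w _; rewrite mulrDr. Qed.

Lemma prod_meanZ c f : prod_mean (fun w => c * f w) = c * prod_mean f.
Proof. by rewrite mulr_sumr; apply: eq_bigr => w _; rewrite mulrCA. Qed.

Lemma prod_mean_sum (I : finType) (F : I -> {ffun T -> S} -> R) :
  prod_mean (fun w => \sum_i F i w) = \sum_i prod_mean (F i).
Proof. by rewrite exchange_big; apply: eq_bigr => w _; rewrite mulr_sumr. Qed.

Lemma eq_resample_mean t g1 g2 :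
  g1 =2 g2 -> resample_mean t g1 = resample_mean t g2.
Proof.
by move=> eq_g; apply: eq_prod_mean => w; apply: eq_bigr => s _; rewrite eq_g.
Qed.

Lemma resample_meanD t g1 g2 :
  resample_mean t (fun w w' => g1 w w' + g2 w w') =
  resample_mean t g1 + resample_mean t g2.
Proof.
rewrite -prod_meanD; apply: eq_prod_mean => w.
by rewrite -big_split; apply: eq_bigr => s _; rewrite mulrDr.
Qed.

Lemma resample_meanZ t c g :
  resample_mean t (fun w w' => c * g w w') = c * resample_mean t g.
Proof.
rewrite -prod_meanZ; apply: eq_prod_mean => w.
by rewrite mulr_sumr; apply: eq_bigr => s _; rewrite mulrCA.
Qed.

Hypothesis P_ge0 : forall t s, 0 <= P t s.
Hypothesis P_sum1 : forall t, \sum_s P t s = 1.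

Lemma prod_weight_ge0 w : 0 <= prod_weight w.
Proof. exact: prodr_ge0. Qed.

Lemma prod_mean1 : prod_mean (fun=> 1) = 1.
Proof.
rewrite /prod_mean; under eq_bigr do rewrite mulr1.
by rewrite -(bigA_distr_bigA P) big1.
Qed.

Lemma prod_mean_ge0 f : (forall w, 0 <= f w) -> 0 <= prod_mean f.
Proof.
by move=> f_ge0; apply: sumr_ge0 => w _; rewrite mulr_ge0 ?prod_weight_ge0.
Qed.

Lemma le_prod_mean f1 f2 :
  (forall w, f1 w <= f2 w) -> prod_mean f1 <= prod_mean f2.
Proof.
by move=> le_f; apply: ler_sum => w _; rewrite ler_wpM2l ?prod_weight_ge0.
Qed.

Lemma le_resample_mean t g1 g2 :
  (forall w s, g1 w (resample w t s) <= g2 w (resample w t s)) ->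
  resample_mean t g1 <= resample_mean t g2.
Proof.
move=> le_g; apply: le_prod_mean => w; apply: ler_sum => s _.
by rewrite ler_wpM2l.
Qed.

Lemma resample_mean_fst t f : resample_mean t (fun w _ => f w) = prod_mean f.
Proof. by apply: eq_prod_mean => w; rewrite -mulr_suml P_sum1 mul1r. Qed.

(* Asking for [c < f] off [E] allows [c = 0]: then [f] is almost surely zero. *)
Lemma prod_mean_markov (E : pred {ffun T -> S}) f (c d : R) :
  0 <= d -> 0 <= c -> (forall w, 0 <= f w) -> (forall w, ~~ E w -> c < f w) ->
  prod_mean f <= d * c -> 1 - d <= prod_mean (fun w => (E w)%:R).
Proof.
move=> d_ge0 c_ge0 f_ge0 f_gt mean_le.
have := c_ge0; rewrite le0r => /predU1P[c0|c_gt0].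
  have mean0 : prod_mean f = 0.
    by apply/le_anti; rewrite prod_mean_ge0 // (le_trans mean_le) // c0 mulr0.
  have f_ae0 w : prod_weight w * f w = 0.
    apply: (psumr_eq0P _ mean0) => // u _.
    by rewrite mulr_ge0 ?prod_weight_ge0.
  apply: (@le_trans _ _ 1); first by rewrite gerBl.
  rewrite -[leLHS]prod_mean1; apply: ler_sum => w _.
  case: (boolP (E w)) => [//|/f_gt].
  rewrite c0 => fw_gt0; have /eqP := f_ae0 w.
  by rewrite mulf_eq0 (gt_eqF fw_gt0) orbF => /eqP ->; rewrite !mul0r.
rewrite lerBlDr -lerBlDl -(ler_pM2r c_gt0) (le_trans _ mean_le) //.
rewrite -[X in X - _]prod_mean1 -sumrB mulr_suml; apply: ler_sum => w _.
rewrite -mulrBr -mulrA ler_wpM2l ?prod_weight_ge0 //.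
case: (boolP (E w)) => [_|/f_gt/ltW]; first by rewrite subrr mul0r.
by rewrite subr0 mul1r.
Qed.

Section MomentsOfSums.
Variables (d : T -> S -> R) (L M : R).
Hypothesis d_bound : forall t s, 0 <= d t s <= L.
Hypothesis L_ge0 : 0 <= L.
Hypothesis d_mean : \sum_t \sum_s P t s * d t s <= M.

Let D w := \sum_t d t (w t).

Let d_ge0 t s : 0 <= d t s.
Proof. by case/andP: (d_bound t s). Qed.

Let D_ge0 w : 0 <= D w.
Proof. exact: sumr_ge0. Qed.

Lemma sum_coord_le_resample w t s : D w <= D (resample w t s) + L.
Proof.
rewrite /D (bigD1 t) // [X in _ <= X + _](bigD1 t) //= resampleE addrAC.
apply: lerD.
  by have /andP[_ d_leL] := d_bound t (w t); rewrite (le_trans d_leL) // lerDr.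
by apply: ler_sum => u ut; rewrite resample_neq.
Qed.

Lemma coord_mul_moment_le t (a : R) k : 0 <= a ->
  prod_mean (fun w => d t (w t) * (D w + a) ^+ k) <=
  (\sum_s P t s * d t s) * prod_mean (fun w => (D w + (a + L)) ^+ k).
Proof.
move=> a_ge0.
rewrite -(resample_mean_fst t) -prod_meanZ.
apply: (@le_trans _ _ (resample_mean t
    (fun w w' => d t (w t) * (D w' + (a + L)) ^+ k))).
  apply: le_resample_mean => w s.
  rewrite ler_wpM2l // lerXn2r ?nnegrE ?addr_ge0 //.
  by rewrite [a + L]addrC addrA lerD2r sum_coord_le_resample.
rewrite resample_meanC le_eqVlt; apply/orP; left; apply/eqP/eq_prod_mean => w.
by rewrite mulr_suml; apply: eq_bigr => s _; rewrite resampleE mulrA.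
Qed.

Lemma sum_coord_moment_le (a : R) k : 0 <= a ->
  prod_mean (fun w => (D w + a) ^+ k) <= (M + a + k%:R * L) ^+ k.
Proof.
have M_ge0 : 0 <= M.
  by apply: le_trans d_mean; do 2!apply: sumr_ge0 => ? _; rewrite mulr_ge0.
elim: k a => [|k IHk] a a_ge0.
  by rewrite (@eq_prod_mean _ (fun=> 1)) ?prod_mean1.
have aL_ge0 : 0 <= a + L by rewrite addr_ge0.
have m_ge0 : 0 <= prod_mean (fun w => (D w + (a + L)) ^+ k).
  by apply: prod_mean_ge0 => w; rewrite exprn_ge0 ?addr_ge0.
apply: (@le_trans _ _ ((M + a) * prod_mean (fun w => (D w + (a + L)) ^+ k))).
  rewrite (@eq_prod_mean _ (fun w =>
      \sum_t d t (w t) * (D w + a) ^+ k + a * (D w + a) ^+ k)); last first.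
    by move=> w; rewrite exprS mulrDl -mulr_suml.
  rewrite prod_meanD prod_meanZ prod_mean_sum mulrDl lerD //.
    apply: le_trans (ler_wpM2r m_ge0 d_mean); rewrite mulr_suml.
    by apply: ler_sum => t _; exact: coord_mul_moment_le.
  rewrite ler_wpM2l //; apply: le_prod_mean => w.
  by rewrite lerXn2r ?nnegrE ?addr_ge0 // addrA lerDl.
rewrite exprS ler_pM ?addr_ge0 //; first by rewrite lerDl mulr_ge0.
apply: le_trans (IHk _ aL_ge0) _.
by rewrite -(natr1 k) mulrDl mul1r -!addrA [L + _]addrC.
Qed.

End MomentsOfSums.
End ProductMean.

(** * Sums of independent symmetric random matrices *)

Section IndependentMatrixSum.
Variables (R : realDomainType) (T S : finType) (P : T -> S -> R).
Hypothesis P_ge0 : forall t s, 0 <= P t s.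
Hypothesis P_sum1 : forall t, \sum_s P t s = 1.
Variables (n : nat) (B : T -> S -> 'M[R]_n).
Implicit Types (w : {ffun T -> S}) (t : T) (s : S).

Definition coord_sum w : 'M[R]_n := \sum_t B t (w t).

Definition mean_sqr_dev t s : 'M[R]_n :=
  \sum_s' P t s' *: (B t s - B t s') ^+ 2.

Lemma coord_sumB_resample w t s :
  coord_sum w - coord_sum (resample w t s) = B t (w t) - B t s.
Proof.
rewrite /coord_sum (bigD1 t) //= [X in _ - X](bigD1 t) //= resampleE.
rewrite [X in _ - (_ + X)](eq_bigr (fun u => B u (w u))) => [|u ut].
  by rewrite opprD addrACA subrr addr0.
by rewrite resample_neq.
Qed.

Hypothesis B_sym : forall t s, (B t s)^T = B t s.
Hypothesis B_centered : forall t, \sum_s P t s *: B t s = 0.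

Local Notation X := coord_sum.

Lemma coord_sum_sym w : (X w)^T = X w.
Proof. by rewrite raddf_sum; apply: eq_bigr => t _; exact: B_sym. Qed.

(* Resampling [t] changes only the summand [t] of [X], so the centering of that
   summand brings in [X w - X w'], and exchanging [w] with [w'] antisymmetrizes
   the power of [X]. *)
Lemma centered_coord_trace t N :
  prod_mean P (fun w => \tr (B t (w t) * X w ^+ N)) *+ 2 =
  resample_mean P t (fun w w' => \tr ((X w - X w') * (X w ^+ N - X w' ^+ N))).
Proof.
pose G w w' := \tr ((X w - X w') * X w ^+ N).
have GE :
    resample_mean P t G = prod_mean P (fun w => \tr (B t (w t) * X w ^+ N)).
  apply: eq_prod_mean => w; rewrite /G.
  under eq_bigr do
    rewrite coord_sumB_resample -mxtraceZ -mulmxE scalemxAl scalerBr.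
  rewrite -raddf_sum -mulmx_suml sumrB B_centered subr0 -scaler_suml P_sum1.
  by rewrite scale1r.
rewrite mulr2n -GE {2}resample_meanC -resample_meanD.
apply: eq_resample_mean => w w'; rewrite -mxtraceD; congr (\tr _).
by rewrite -[X w' - X w]opprB mulNr -mulrBr.
Qed.

Lemma trace_moment_step u :
  prod_mean P (fun w => \tr (X w ^+ u.+1.*2)) *+ 2 <=
  u.*2.+1%:R * prod_mean P (fun w =>
     \sum_t \tr (mean_sqr_dev t (w t) * X w ^+ u.*2)).
Proof.
rewrite (@eq_prod_mean _ _ _ _ _ (fun w =>
    \sum_t \tr (B t (w t) * X w ^+ u.*2.+1))); last first.
  by move=> w; rewrite doubleS exprS {1}/coord_sum mulr_suml raddf_sum.
rewrite !prod_mean_sum -sumrMnl mulr_sumr; apply: ler_sum => t _.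
pose V w w' := \tr ((X w - X w') ^+ 2 * X w ^+ u.*2).
have VE : resample_mean P t V =
    prod_mean P (fun w => \tr (mean_sqr_dev t (w t) * X w ^+ u.*2)).
  apply: eq_prod_mean => w; rewrite /V.
  under eq_bigr do rewrite coord_sumB_resample -mxtraceZ -mulmxE scalemxAl.
  by rewrite -raddf_sum -mulmx_suml.
rewrite centered_coord_trace -VE -(ler_pMn2r (ltn0Sn 1)) -mulrnAr.
rewrite [in leRHS]mulr2n {2}(resample_meanC _ t V) -resample_meanD.
rewrite -[leLHS]mulr_natl -!resample_meanZ; apply: le_resample_mean => // w s.
have := mxtrace_mean_value_le u (coord_sum_sym w)
  (coord_sum_sym (resample w t s)).
by rewrite -[leLHS]mulr_natl /V -[X (resample w t s) - _]opprB sqrrN.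
Qed.

Variables (v : T -> S -> 'rV[R]_n) (L M : R).
Hypothesis mean_sqr_devE : forall t s, mean_sqr_dev t s = diag_mx (v t s).
Hypothesis v_bound : forall t s x, 0 <= v t s 0 x <= L.
Hypothesis L_ge0 : 0 <= L.
Hypothesis v_mean : forall x, \sum_t \sum_s P t s * v t s 0 x <= M.

Let D w : 'rV[R]_n := \sum_t v t (w t).

Let D_ge0 w x : 0 <= D w 0 x.
Proof.
by rewrite summxE sumr_ge0 // => t _; case/andP: (v_bound t (w t) x).
Qed.

Lemma trace_moment_le_diag u :
  prod_mean P (fun w => \tr (X w ^+ u.+1.*2)) <=
  \sum_x prod_mean P (fun w => (u.*2.+1%:R * D w 0 x) ^+ u.+1).
Proof.
have diagE w : \sum_t \tr (mean_sqr_dev t (w t) * X w ^+ u.*2) =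
    \tr (diag_mx (D w) * X w ^+ u.*2).
  under eq_bigr do rewrite mean_sqr_devE.
  by rewrite -raddf_sum -mulr_suml /D raddf_sum.
have := trace_moment_step u; rewrite (eq_prod_mean _ diagE) -prod_meanZ.
rewrite mulr2n -lerBrDl => /le_trans; apply.
rewrite lerBlDl -prod_mean_sum -prod_meanD; apply: le_prod_mean => // w.
exact: mxtrace_diag_mul_young (coord_sum_sym w) _ _.
Qed.

Lemma trace_moment_le u :
  prod_mean P (fun w => \tr (X w ^+ u.+1.*2)) <=
  n%:R * (2 * u.+1%:R * (M + u.+1%:R * L)) ^+ u.+1.
Proof.
apply: le_trans (trace_moment_le_diag u) _; rewrite mulr_natl.
rewrite -[X in _ <= _ *+ X](card_ord n) -sumr_const; apply: ler_sum => x _.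
under eq_prod_mean do rewrite exprMn.
rewrite prod_meanZ exprMn ler_pM ?exprn_ge0 ?ler0n //.
- by apply: prod_mean_ge0 => // w; rewrite exprn_ge0.
- by rewrite lerXn2r ?nnegrE ?mulr_ge0 // -natrM ler_nat; lia.
have := @sum_coord_moment_le _ _ _ P P_ge0 P_sum1 (fun t s => v t s 0 x) L M.
move=> /(_ _ _ _ 0 u.+1); rewrite addr0.
by under eq_prod_mean do rewrite addr0 -summxE; exact.
Qed.

End IndependentMatrixSum.

Section BernoulliMatrixSum.
Variables (R : realDomainType) (T : finType) (p : T -> R).
Hypothesis p01 : forall t, 0 <= p t <= 1.
Variables (n : nat) (A : T -> 'M[R]_n).

Definition bernoulli (t : T) (b : bool) : R := if b then p t else 1 - p t.

Definition centered_bernoulli_mx (t : T) (b : bool) : 'M[R]_n :=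
  (b%:R - p t) *: A t.

Lemma bernoulli_ge0 t b : 0 <= bernoulli t b.
Proof. by have /andP[? ?] := p01 t; case: b; rewrite //= subr_ge0. Qed.

Lemma bernoulli_sum1 t : \sum_b bernoulli t b = 1.
Proof. by rewrite big_bool /= addrC subrK. Qed.

Hypothesis A_sym : forall t, (A t)^T = A t.
Variables (a : T -> 'rV[R]_n) (L M : R).
Hypothesis A_sqr : forall t, A t ^+ 2 = diag_mx (a t).
Hypothesis a_bound : forall t x, 0 <= a t 0 x <= L.
Hypothesis L_ge0 : 0 <= L.
Hypothesis a_mean : forall x, \sum_t p t * a t 0 x <= M.

Lemma bernoulli_trace_moment_le u :
  prod_mean bernoulli
    (fun w => \tr (coord_sum centered_bernoulli_mx w ^+ u.+1.*2)) <=
  n%:R * (2 * u.+1%:R * (M *+ 2 + u.+1%:R * L)) ^+ u.+1.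
Proof.
apply: (@trace_moment_le _ _ _ bernoulli _ _ _ _ _ _
  (fun t b => bernoulli t (~~ b) *: a t)) => //.
- exact: bernoulli_ge0.
- exact: bernoulli_sum1.
- by move=> t b; rewrite linearZ /= A_sym.
- move=> t; rewrite big_bool /= !scalerA -scalerDl.
  rewrite [X in X *: _](_ : _ = 0) ?scale0r //.
  by rewrite /bernoulli /=; ring.
- move=> t b; rewrite /mean_sqr_dev /centered_bernoulli_mx big_bool /=.
  rewrite -!scalerBl !expr2_scalemx A_sqr !scalerA -scalerDl linearZ /=.
  by congr (_ *: _); rewrite /bernoulli; case: b => /=; ring.
- move=> t b x; rewrite mxE; have /andP[a_ge0 a_leL] := a_bound t x.
  rewrite mulr_ge0 ?bernoulli_ge0 // (le_trans _ a_leL) // ler_piMl //.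
  by have /andP[? ?] := p01 t; case: b; rewrite //= gerBl.
move=> x; rewrite mulr2n; apply: le_trans (lerD (a_mean x) (a_mean x)).
rewrite -big_split; apply: ler_sum => t _ /=; rewrite big_bool /= !mxE.
have /andP[a_ge0 _] := a_bound t x; have /andP[p_ge0 p_le1] := p01 t.
rewrite /bernoulli; nra.
Qed.

End BernoulliMatrixSum.

(** * Spectral norm and incoherence *)

Lemma sqr_vnorm2 (k : nat) (x : 'cV[RR]_k) : vnorm2 x ^+ 2 = sqnorm x.
Proof. by rewrite sqr_sqrtr ?sqnorm_ge0. Qed.

Lemma vnorm2_le1 (k : nat) (x : 'cV[RR]_k) : (vnorm2 x <= 1) = (sqnorm x <= 1).
Proof.
by rewrite -sqr_vnorm2 -[in RHS](expr1n _ 2) ler_pXn2r ?nnegrE ?sqrtr_ge0.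
Qed.

Section SpectralNorm.
Variables (n m : nat) (M : 'M[RR]_(n, m)).

Lemma vnorm2_mulmx_le_spec_norm (x : 'cV[RR]_m) :
  vnorm2 x <= 1 -> vnorm2 (M *m x) <= spec_norm M.
Proof.
move=> x_le1; apply: ub_le_sup; last by exists x.
exists (Num.sqrt (\sum_i \sum_j M i j ^+ 2)) => _ [z [z_le1 ->]].
apply: ler_wsqrtr; apply: ler_sum => i _; rewrite mxE.
apply: le_trans (cauchy_schwarz_sum _ _) _.
by rewrite ler_piMr -?vnorm2_le1 // sum_sqr_ge0.
Qed.

Lemma spec_norm_le (c : RR) :
  (forall x : 'cV[RR]_m, vnorm2 x <= 1 -> vnorm2 (M *m x) <= c) ->
  spec_norm M <= c.
Proof.
move=> M_le; apply: ge_sup => [|_ [x [x_le1 ->]]]; last exact: M_le.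
exists (vnorm2 (M *m 0)), 0; split=> //.
by rewrite vnorm2_le1 /sqnorm big1 // => i _; rewrite mxE expr0n.
Qed.

Lemma spec_norm_ge0 : 0 <= spec_norm M.
Proof.
apply: le_trans (vnorm2_mulmx_le_spec_norm (_ : vnorm2 0 <= 1)).
  exact: sqrtr_ge0.
by rewrite vnorm2_le1 /sqnorm big1 // => i _; rewrite mxE expr0n.
Qed.

End SpectralNorm.

Lemma lt_spec_norm_trace (n : nat) (S : 'M[RR]_n) (k : nat) (c : RR) :
  S^T = S -> 0 <= c -> c < spec_norm S -> c ^+ k.+1.*2 < \tr (S ^+ k.+1.*2).
Proof.
move=> S_sym c_ge0; apply: contraTT; rewrite -!leNgt => trace_le.
apply: spec_norm_le => x; rewrite vnorm2_le1.
move=> /(sqnorm_mulmx_exp_le_trace k S_sym)/le_trans/(_ trace_le).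
by rewrite -sqr_vnorm2 -exprM mul2n ler_pXn2r ?nnegrE ?sqrtr_ge0.
Qed.

Section SingularValues.
Variables (n m r : nat) (U : 'M[RR]_(n, r)) (S : 'rV[RR]_r) (V : 'M[RR]_(m, r)).
Hypothesis UU : U^T *m U = 1%:M.
Hypothesis VV : V^T *m V = 1%:M.

Let A := U *m diag_mx S *m V^T.

Lemma sqr_singular_value_le_spec_norm k : S 0 k ^+ 2 <= spec_norm A ^+ 2.
Proof.
have AVk : A *m col k V = S 0 k *: col k U.
  rewrite colE mulmxA -colE -mulmxA VV mulmx1; apply/colP => i.
  by rewrite mul_mx_diag !mxE mulrC.
have Vk_le1 : vnorm2 (col k V) <= 1.
  by rewrite vnorm2_le1 sqnorm_col_orthonormal.
apply: le_trans (_ : vnorm2 (A *m col k V) ^+ 2 <= _); last first.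
  rewrite ler_pXn2r ?nnegrE ?sqrtr_ge0 ?spec_norm_ge0 //.
  exact: vnorm2_mulmx_le_spec_norm.
rewrite sqr_vnorm2 AVk /sqnorm; under eq_bigr do rewrite mxE exprMn.
by rewrite -mulr_sumr [X in _ * X]sqnorm_col_orthonormal // mulr1.
Qed.

Lemma sum_sqr_mul_singular_value_le (f : 'I_r -> RR) (c : RR) :
  \sum_k f k ^+ 2 <= c ->
  \sum_k (f k * S 0 k) ^+ 2 <= c * spec_norm A ^+ 2.
Proof.
move=> f_le; apply: le_trans (ler_wpM2r (sqr_ge0 _) f_le); rewrite mulr_suml.
apply: ler_sum => k _; rewrite exprMn ler_wpM2l ?sqr_ge0 //.
exact: sqr_singular_value_le_spec_norm.
Qed.

Variables alpha beta : RR.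
Hypothesis U_row_le : forall i, \sum_k U i k ^+ 2 <= alpha.
Hypothesis V_row_le : forall l, \sum_k V l k ^+ 2 <= beta.

Lemma sum_sqr_row_le i : \sum_l A i l ^+ 2 <= alpha * spec_norm A ^+ 2.
Proof.
rewrite sum_sqr_mulmx_trmx // mul_mx_diag; under eq_bigr do rewrite mxE.
exact: sum_sqr_mul_singular_value_le.
Qed.

Lemma sum_sqr_col_le l : \sum_i A i l ^+ 2 <= beta * spec_norm A ^+ 2.
Proof.
under eq_bigr => i _ do rewrite -[A]trmxK mxE.
rewrite !trmx_mul trmxK tr_diag_mx mulmxA sum_sqr_mulmx_trmx // mul_mx_diag.
under eq_bigr do rewrite mxE.
exact: sum_sqr_mul_singular_value_le.
Qed.

Lemma sqr_entry_le i l : A i l ^+ 2 <= alpha * beta * spec_norm A ^+ 2.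
Proof.
have -> : A i l = \sum_k U i k * (V l k * S 0 k).
  by rewrite mxE; apply: eq_bigr => k _; rewrite mul_mx_diag !mxE mulrAC mulrA.
apply: le_trans (cauchy_schwarz_sum _ _) _.
rewrite -mulrA ler_pM ?sum_sqr_ge0 //.
exact: sum_sqr_mul_singular_value_le.
Qed.

End SingularValues.

Lemma uniform_le_div_ge0 (n : nat) (f : 'I_n -> RR) (c : RR) :
  (forall i, 0 <= f i) -> (forall i, f i <= c / n%:R) -> 0 <= c / n%:R.
Proof.
case: n f => [|n] f f_ge0 f_le; first by rewrite invr0 mulr0.
exact: le_trans (f_ge0 ord0) (f_le ord0).
Qed.

Lemma incoherent_bounds (n m r : nat) (A : 'M[RR]_(n, m)) (mu1 mu2 : RR) :
  let alpha := mu1 * r%:R / n%:R in let beta := mu2 * r%:R / m%:R in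
  let N := spec_norm A ^+ 2 in
  incoherent A r mu1 mu2 ->
  [/\ 0 <= alpha * beta,
      forall i l, A i l ^+ 2 <= alpha * beta * N &
      forall i, \sum_l \sum_j A i l ^+ 2 * A j l ^+ 2 <= alpha * beta * N ^+ 2].
Proof.
move=> alpha beta N [U [S [V [UU [VV [_ [AE [U_row_le V_row_le]]]]]]]].
have alpha_ge0 : 0 <= alpha.
  exact: uniform_le_div_ge0 (fun i => sum_sqr_ge0 (U i)) U_row_le.
have beta_ge0 : 0 <= beta.
  exact: uniform_le_div_ge0 (fun l => sum_sqr_ge0 (V l)) V_row_le.
rewrite /N AE; split=> [|i l|i]; first exact: mulr_ge0.
  exact: sqr_entry_le.
set B := _ *m V^T; rewrite expr2 mulrACA.
apply: (@le_trans _ _ (\sum_l B i l ^+ 2 * (beta * spec_norm B ^+ 2))).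
  apply: ler_sum => l _; rewrite -mulr_sumr.
  by rewrite ler_wpM2l ?sqr_ge0 ?sum_sqr_col_le.
by rewrite -mulr_suml ler_wpM2r ?sum_sqr_row_le // mulr_ge0 ?sqr_ge0.
Qed.

(** * The wedge matrix *)

Lemma sum_triple (V : nmodType) (I J K : finType) (F : I * J * K -> V) :
  \sum_t F t = \sum_i \sum_j \sum_k F (i, j, k).
Proof. by rewrite !pair_bigA; apply: eq_bigr => -[[]]. Qed.

Section SymmetricDelta.
Variables (R : pzRingType) (n : nat).

(* Summing over all pairs [(i, j)] counts each unordered pair once. *)
Definition sym_delta_mx (i j : 'I_n) : 'M[R]_n :=
  if (i < j)%N then delta_mx i j + delta_mx j i
  else if i == j then delta_mx i i else 0.

Lemma sym_delta_mx_sym i j : (sym_delta_mx i j)^T = sym_delta_mx i j.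
Proof.
rewrite /sym_delta_mx; case: ifP => _.
  by rewrite linearD /= !trmx_delta addrC.
by case: ifP => _; rewrite ?trmx_delta ?trmx0.
Qed.

Lemma delta_mx_diag (i : 'I_n) :
  delta_mx i i = diag_mx (delta_mx 0 i) :> 'M[R]_n.
Proof.
apply/matrixP => x y; rewrite !mxE eqxx /=.
case: (eqVneq x y) => [<-|]; first by rewrite andbb.
by case: (eqVneq x i) => //= ->; rewrite eq_sym => /negPf->.
Qed.

Lemma sym_delta_mx_sqr i j :
  sym_delta_mx i j ^+ 2 =
  diag_mx (\row_x ((i <= j)%N && ((x == i) || (x == j)))%:R).
Proof.
rewrite expr2 -mulmxE /sym_delta_mx; case: ltngtP => [ij|ij|/val_inj<-] /=.
- have ji : j != i by rewrite -(inj_eq val_inj) gtn_eqF.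
  rewrite mulmxDl !mulmxDr !mul_delta_mx !mul_delta_mx_0 // 1?eq_sym //.
  rewrite add0r addr0 !delta_mx_diag -raddfD; congr diag_mx; apply/rowP => x.
  rewrite !mxE eqxx /=; case: (eqVneq x i) => [->|_] /=; last by rewrite add0r.
  by rewrite eq_sym (negPf ji) addr0.
- rewrite -(inj_eq val_inj) gtn_eqF // mul0mx.
  by apply/matrixP => x y; rewrite !mxE mul0rn.
- rewrite eqxx mul_delta_mx delta_mx_diag; congr diag_mx; apply/rowP => x.
  by rewrite !mxE eqxx orbb.
Qed.

Lemma sum_sym_delta_mx (G : 'I_n -> 'I_n -> R) :
  \sum_i \sum_j G i j *: sym_delta_mx i j =
  \sum_(i < n) \sum_(j < n | (i < j)%N) G i j *: (delta_mx i j + delta_mx j i)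
  + \sum_i G i i *: delta_mx i i.
Proof.
rewrite -big_split; apply: eq_bigr => i _ /=.
rewrite (bigID (fun j : 'I_n => (i < j)%N)) /=; congr (_ + _).
  by apply: eq_bigr => j lt_ij; rewrite /sym_delta_mx lt_ij.
rewrite (bigD1 i) ?ltnn //= big1 => [|j /andP[/negPf ij /negPf ji]].
  by rewrite addr0 /sym_delta_mx ltnn eqxx.
by rewrite /sym_delta_mx ij eq_sym ji scaler0.
Qed.

Lemma sum_sym_delta_mx_sym (G : 'M[R]_n) : G^T = G ->
  \sum_i \sum_j G i j *: sym_delta_mx i j = G.
Proof.
move=> G_sym; have GC i j : G i j = G j i by rewrite -[in LHS]G_sym mxE.
have deltaE i j : sym_delta_mx i j = delta_mx i j +
    ((i < j)%N%:R *: delta_mx j i - (j < i)%N%:R *: delta_mx i j).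
  rewrite /sym_delta_mx; case: ltngtP => [ij|ij|/val_inj->].
  - by rewrite scale1r scale0r subr0.
  - by rewrite -(inj_eq val_inj) gtn_eqF // scale0r scale1r sub0r subrr.
  - by rewrite eqxx !scale0r subrr addr0.
have cancel : \sum_(i < n) \sum_(j < n)
    G i j *: ((i < j)%N%:R *: delta_mx j i - (j < i)%N%:R *: delta_mx i j) = 0.
  under eq_bigr do under eq_bigr do rewrite scalerBr.
  under eq_bigr do rewrite sumrB.
  rewrite sumrB exchange_big /= -sumrB big1 // => i _.
  by rewrite -sumrB big1 // => j _; rewrite GC subrr.
rewrite [RHS]matrix_sum_delta -[RHS]addr0 -[X in _ + X]cancel -big_split.
apply: eq_bigr => i _; rewrite -big_split; apply: eq_bigr => j _ /=.
by rewrite -scalerDr deltaE.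
Qed.

End SymmetricDelta.
Arguments sym_delta_mx {R n} i j.

Lemma sumr_mul_pred1 (R : pzRingType) (I : finType) (F : I -> R) (x : I) :
  \sum_i F i * (x == i)%:R = F x.
Proof.
rewrite (bigD1 x) //= eqxx mulr1 big1 ?addr0 // => i /negPf ix.
by rewrite eq_sym ix mulr0.
Qed.

Section WedgeDecomposition.
Variables (n m : nat) (A : 'M[RR]_(n, m)) (p : RR).
Local Notation T := ('I_n * 'I_m * 'I_n)%type.

Definition wedge_rate (t : T) : RR := if inW t then p else 0.

Definition wedge_mx (t : T) : 'M[RR]_n :=
  (p^-1 * A t.1.1 t.1.2 * A t.2 t.1.2) *: sym_delta_mx t.1.1 t.2.

Definition wedge_sqr (t : T) : 'rV[RR]_n :=
  (p^-1 * A t.1.1 t.1.2 * A t.2 t.1.2) ^+ 2 *: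
  \row_x (inW t && ((x == t.1.1) || (x == t.2)))%:R.

Lemma weightE (w : Omega n m) :
  weight p w = prod_weight (bernoulli wedge_rate) w.
Proof.
apply: eq_bigr => t _; rewrite /bernoulli /wedge_rate.
by case: (inW t); case: (w t); rewrite ?subr0.
Qed.

Lemma probE (E : Omega n m -> Prop) :
  prob p E = prod_mean (bernoulli wedge_rate) (fun w => `[< E w >]%:R).
Proof.
apply: eq_bigr => w _; rewrite weightE.
by case: asboolP; rewrite ?mulr1 ?mulr0.
Qed.

Lemma wedge_mx_sym t : (wedge_mx t)^T = wedge_mx t.
Proof. by rewrite linearZ /= sym_delta_mx_sym. Qed.

Lemma wedge_mx_sqr t : wedge_mx t ^+ 2 = diag_mx (wedge_sqr t).
Proof. by rewrite expr2_scalemx sym_delta_mx_sqr linearZ. Qed.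

Lemma wedgeE (w : Omega n m) :
  wedge A p w = \sum_i \sum_j
    (\sum_l p^-1 * A i l * A j l * (w (i, l, j))%:R) *: sym_delta_mx i j.
Proof.
have ZE i l j : Zilj A p w i l j =
    (p^-1 * A i l * A j l * (w (i, l, j))%:R) *: delta_mx i j.
  by rewrite /Zilj; case: (w _).
rewrite sum_sym_delta_mx; congr (_ + _); apply: eq_bigr => i _.
  apply: eq_bigr => j _; rewrite scaler_suml; apply: eq_bigr => l _.
  by rewrite ZE linearZ /= trmx_delta scalerDr.
by rewrite scaler_suml; apply: eq_bigr => l _; rewrite ZE.
Qed.

Lemma wedgeB_gram (w : Omega n m) : p != 0 ->
  wedge A p w - A *m A^T =
  coord_sum (centered_bernoulli_mx wedge_rate wedge_mx) w.
Proof.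
move=> p_neq0; have gram_sym : (A *m A^T)^T = A *m A^T.
  by rewrite trmx_mul trmxK.
rewrite wedgeE -[A *m A^T](sum_sym_delta_mx_sym gram_sym) -sumrB.
rewrite /coord_sum sum_triple; apply: eq_bigr => i _.
rewrite [RHS]exchange_big -sumrB; apply: eq_bigr => j _ /=.
rewrite -scalerBl mxE -sumrB scaler_suml; apply: eq_bigr => l _.
rewrite /centered_bernoulli_mx /wedge_mx /wedge_rate /inW /= mxE scalerA.
have [ij|ji] := leqP i j; first by congr (_ *: _); field.
by rewrite /sym_delta_mx ltnNge ltnW //= -(inj_eq val_inj) gtn_eqF // !scaler0.
Qed.

End WedgeDecomposition.

Section WedgeConcentration.
Variables (n m : nat) (A : 'M[RR]_(n, m)) (p : RR).
Hypothesis p01 : 0 < p <= 1.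

Let p_gt0 : 0 < p.
Proof. by case/andP: p01. Qed.

Lemma wedge_rate01 (t : 'I_n * 'I_m * 'I_n) : 0 <= wedge_rate p t <= 1.
Proof.
have /andP[_ p_le1] := p01; rewrite /wedge_rate.
by case: (inW t); rewrite ?lexx ?ler01 ?(ltW p_gt0).
Qed.

Variables kappa V : RR.
Hypothesis A_entry_le : forall i l, A i l ^+ 2 <= kappa.
Hypothesis V_ge0 : 0 <= V.
Hypothesis A_path_le :
  forall i, \sum_l \sum_j A i l ^+ 2 * A j l ^+ 2 <= V.

Lemma wedge_sqr_bound t x : 0 <= wedge_sqr A p t 0 x <= (kappa / p) ^+ 2.
Proof.
rewrite !mxE; set e := _%:R.
have [e_ge0 e_le1] : 0 <= e /\ e <= 1 by rewrite /e; case: (_ && _).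
rewrite mulr_ge0 ?sqr_ge0 //= (le_trans (ler_piMr _ e_le1)) ?sqr_ge0 //.
rewrite -mulrA exprMn exprMn mulrC exprMn exprVn.
rewrite ler_wpM2r ?invr_ge0 ?sqr_ge0 //.
by rewrite [leRHS]expr2 ler_pM ?sqr_ge0.
Qed.

Lemma wedge_sqr_mean_le x :
  \sum_t wedge_rate p t * wedge_sqr A p t 0 x <= (V / p) *+ 2.
Proof.
pose f (t : 'I_n * 'I_m * 'I_n) := A t.1.1 t.1.2 ^+ 2 * A t.2 t.1.2 ^+ 2.
have f_ge0 t : 0 <= f t by rewrite mulr_ge0 ?sqr_ge0.
apply: (@le_trans _ _
    (\sum_t p^-1 * (f t * (x == t.1.1)%:R + f t * (x == t.2)%:R))).
  apply: ler_sum => t _; rewrite /wedge_rate !mxE.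
  case: (inW t) => /=; last first.
    by rewrite mul0r mulr_ge0 ?invr_ge0 ?(ltW p_gt0) // addr_ge0 // mulr_ge0.
  have -> : p * ((p^-1 * A t.1.1 t.1.2 * A t.2 t.1.2) ^+ 2 *
      ((x == t.1.1) || (x == t.2))%:R) =
    p^-1 * (f t * ((x == t.1.1) || (x == t.2))%:R).
    by rewrite /f; field; rewrite gt_eqF.
  rewrite ler_wpM2l ?invr_ge0 ?(ltW p_gt0) // -mulrDr ler_wpM2l //.
  rewrite -natrD ler_nat; by case: (x == _); case: (x == _).
rewrite -mulr_sumr big_split mulrC -mulrnAl.
rewrite ler_wpM2r ?invr_ge0 ?(ltW p_gt0) //=.
rewrite mulr2n lerD // sum_triple /=.
  under eq_bigr do under eq_bigr do rewrite -mulr_suml.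
  under eq_bigr do rewrite -mulr_suml.
  by rewrite sumr_mul_pred1; exact: A_path_le.
under eq_bigr do under eq_bigr do rewrite sumr_mul_pred1.
rewrite exchange_big; under eq_bigr do under eq_bigr do rewrite /f mulrC.
exact: A_path_le.
Qed.

Local Notation X := (fun w => wedge A p w - A *m A^T).

Lemma wedge_trace_moment_le u :
  prod_mean (bernoulli (wedge_rate p)) (fun w => \tr (X w ^+ u.+1.*2)) <=
  n%:R * (2 * u.+1%:R *
          ((V / p) *+ 2 *+ 2 + u.+1%:R * (kappa / p) ^+ 2)) ^+ u.+1.
Proof.
under eq_prod_mean do rewrite wedgeB_gram ?gt_eqF //.
apply: (bernoulli_trace_moment_le wedge_rate01 (wedge_mx_sym A p)
  (wedge_mx_sqr A p)).
- exact: wedge_sqr_bound.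
- exact: sqr_ge0.
- exact: wedge_sqr_mean_le.
Qed.

Lemma wedge_spec_norm_tail u (c : RR) :
  0 <= c ->
  2 * u.+1%:R * ((V / p) *+ 2 *+ 2 + u.+1%:R * (kappa / p) ^+ 2) <=
    c ^+ 2 * expR (- 2) ->
  1 - n%:R * expR (- (2 * u.+1%:R)) <= prob p (fun w => spec_norm (X w) <= c).
Proof.
move=> c_ge0 c_large.
have X_sym w : (X w)^T = X w.
  rewrite wedgeB_gram ?gt_eqF // coord_sum_sym // => t b.
  by rewrite linearZ /= wedge_mx_sym.
rewrite probE; apply: (@prod_mean_markov _ _ _ _ _ _ _
    (fun w => \tr (X w ^+ u.+1.*2)) (c ^+ u.+1.*2)).
- by move=> t b; exact: bernoulli_ge0 wedge_rate01 _ _.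
- exact: bernoulli_sum1.
- by rewrite mulr_ge0 ?expR_ge0.
- exact: exprn_ge0.
- by move=> w; exact: mxtrace_expr_double_ge0.
- move=> w /asboolPn/negP; rewrite -ltNge.
  exact: lt_spec_norm_trace (X_sym w) c_ge0.
apply: le_trans (wedge_trace_moment_le u) _; rewrite -[leRHS]mulrA ler_wpM2l //.
have -> : expR (- (2 * u.+1%:R)) * c ^+ u.+1.*2 = (c ^+ 2 * expR (- 2)) ^+ u.+1.
  by rewrite exprMn -exprM mul2n -expRM_natr mulNr mulrC.
rewrite lerXn2r // nnegrE; last by rewrite mulr_ge0 ?sqr_ge0 ?expR_ge0.
have Vp_ge0 : 0 <= V / p by rewrite divr_ge0 // ltW.
apply: mulr_ge0; first exact: mulr_ge0.
by rewrite addr_ge0 ?mulrn_wge0 // mulr_ge0 ?sqr_ge0.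
Qed.

End WedgeConcentration.

Lemma half_le_ln_natr (R : realType) (n : nat) :
  (1 < n)%N -> 2^-1 <= ln n%:R :> R.
Proof.
move=> n_gt1; have n_gt0 : 0 < n%:R :> R by rewrite ltr0n ltnW.
have : ln (1 + (n%:R^-1 - 1)) <= n%:R^-1 - 1 :> R.
  by apply: le_ln1Dx; rewrite ltrBrDl addrN invr_gt0.
rewrite addrC subrK lnV ?posrE // lerNl opprB; apply: le_trans.
have : n%:R^-1 <= 2^-1 :> R by rewrite lef_pV2 ?posrE // ler_nat.
lra.
Qed.

(* The factor [e] of the threshold makes room for the [expR (- 2)] whose [k]-th
   power is the failure probability. *)
Lemma wedge_threshold_large (R : realType) (nu N tau k : R) :
  0 <= nu -> 0 <= k -> k <= 2 * tau ->
  2 * k * ((nu * N ^+ 2) *+ 2 *+ 2 + k * (nu * N) ^+ 2) <=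
  (4 * expR 1 * (Num.sqrt (nu * tau) + nu * tau) * N) ^+ 2 * expR (- 2).
Proof.
move=> nu_ge0 k_ge0 k_le; set y := nu * tau.
have tau_ge0 : 0 <= tau by lra.
have y_ge0 : 0 <= y by rewrite mulr_ge0.
have expR2 : expR 1 ^+ 2 * expR (- 2) = 1 :> R.
  by rewrite -expRM_natl mulr1 -expRD subrr expR0.
rewrite [leRHS](_ : _ = 16 * (Num.sqrt y + y) ^+ 2 * N ^+ 2 *
  (expR 1 ^+ 2 * expR (- 2))); last by ring.
rewrite expR2 mulr1; have := sqr_sqrtr y_ge0; have := sqrtr_ge0 y.
set s := Num.sqrt y => s_ge0 sE.
rewrite [leLHS](_ : _ = 2 * (4 * (k * nu) + (k * nu) ^+ 2) * N ^+ 2);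
  last by ring.
rewrite ler_wpM2r ?sqr_ge0 //.
have : k * nu <= 2 * y by rewrite [leRHS]mulrCA [leLHS]mulrC ler_wpM2l.
have : 0 <= k * nu by rewrite mulr_ge0.
set z := k * nu; nra.
Qed.

Lemma natr_mul_expR_le_powR (R : realType) (n : nat) (a : R) :
  (1 < n)%N -> 1 <= a ->
  n%:R * expR (- (2 * (a * ln n%:R))) <= n%:R `^ (- a).
Proof.
move=> n_gt1 a_ge1; have n_gt0 : 0 < n%:R :> R by rewrite ltr0n ltnW.
rewrite /powR gt_eqF // -[X in X * _]lnK ?posrE // -expRD ler_expR.
have := half_le_ln_natr R n_gt1; nra.
Qed.

Lemma incoherent_wedge_tail (n m r : nat) (A : 'M[RR]_(n, m))
    (mu1 mu2 p tau : RR) :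
  let nu := mu1 * r%:R / n%:R * (mu2 * r%:R / m%:R) / p in
  incoherent A r mu1 mu2 -> 0 < p <= 1 -> 1 <= tau ->
  1 - n%:R * expR (- (2 * tau)) <=
  prob p (fun w : Omega n m => spec_norm (wedge A p w - A *m A^T) <=
    4 * expR 1 * (Num.sqrt (nu * tau) + nu * tau) * spec_norm A ^+ 2).
Proof.
move=> nu A_incoherent p01 tau_ge1; have /andP[p_gt0 _] := p01.
have [ab_ge0 entry_le path_le] := incoherent_bounds A_incoherent.
set N := spec_norm A ^+ 2 in entry_le path_le *.
have nu_ge0 : 0 <= nu by rewrite divr_ge0 // ltW.
have N_ge0 : 0 <= N by exact: sqr_ge0.
have nu_tau_ge0 : 0 <= nu * tau by rewrite mulr_ge0 //; lra.
pose u := Num.truncn tau.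
have tau_lt : tau < u.+1%:R by exact: truncnS_gt.
have u_le : u.+1%:R <= 2 * tau.
  have : u%:R <= tau by rewrite truncn_le; lra.
  by rewrite -natr1; lra.
apply: le_trans (wedge_spec_norm_tail p01 entry_le _ path_le (u := u) _ _).
- by rewrite lerD2l lerN2 ler_wpM2l // ler_expR; lra.
- by rewrite mulr_ge0 ?sqr_ge0.
- apply: mulr_ge0 => //; apply: mulr_ge0; first by rewrite mulr_ge0 ?expR_ge0.
  by rewrite addr_ge0 ?sqrtr_ge0.
set ab := (X in X * N); have -> : ab * N ^+ 2 / p = nu * N ^+ 2.
  by rewrite mulrAC.
have -> : ab * N / p = nu * N by rewrite mulrAC.
exact: wedge_threshold_large.
Qed.

Theorem theorem3p1 :
  exists C : RR, 0 < C /\ exists K : RR, 0 < K /\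
  forall (n m r : nat) (A : 'M[RR]_(n, m)) (mu1 mu2 p a : RR),
    \rank A = r ->
    incoherent A r mu1 mu2 ->
    0 < p <= 1 ->
    2 < a ->
    1 - K * (n%:R `^ (- a)) <=
    prob p (fun w =>
      spec_norm (wedge A p w - A *m A^T) <=
      C * (Num.sqrt (a * mu1 * mu2 * (r%:R ^+ 2) * ln n%:R / (p * m%:R * n%:R))
           + a * mu1 * mu2 * (r%:R ^+ 2) * ln n%:R / (p * m%:R * n%:R))
        * spec_norm A ^+ 2).
Proof.
exists (4 * expR 1); split; first by rewrite mulr_gt0 ?expR_gt0.
exists 1; split=> // n m r A mu1 mu2 p a _ A_incoherent p01 a_gt2.
rewrite mul1r.
have -> : a * mu1 * mu2 * r%:R ^+ 2 * ln n%:R / (p * m%:R * n%:R) =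
    mu1 * r%:R / n%:R * (mu2 * r%:R / m%:R) / p * (a * ln n%:R).
  by rewrite !invfM; ring.
have [n_gt1|] := ltnP 1 n.
  apply: le_trans (incoherent_wedge_tail A_incoherent p01 _).
    by rewrite lerD2l lerN2 natr_mul_expR_le_powR //; lra.
  by have := half_le_ln_natr RR n_gt1; nra.
case: n A A_incoherent => [|[|//]] A A_incoherent _.
  have := incoherent_wedge_tail A_incoherent p01 (lexx 1).
  by rewrite powR0 ?oppr_eq0 ?gt_eqF //; [rewrite invr0 !(mulr0, mul0r)|lra].
rewrite powR1 subrr probE prod_mean_ge0 // => t b.
exact: bernoulli_ge0 (wedge_rate01 p01) t b.
Qed.
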